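(* Assume that the eigenvalues of $p^{-1}B'B$ are bounded away from zero for all large $p$. For the factor model with covariance $\Sigma=B\,\mathrm{cov}(f_t)B'+\Sigma_u$ and with the canonical condition that $\mathrm{cov}(f_t)=I_K$ and $B'B$ is diagonal, we have $$|\lambda_j-\|\tilde b_j\|^2|\le\|\Sigma_u\|\quad\text{for }j\le K,\qquad |\lambda_j|\le\|\Sigma_u\|\quad\text{for }j>K.$$ In addition, for $j\le K$, $\liminf_{p\to\infty}\|\tilde b_j\|^2/p>0$.
   Context: $K$ is a fixed positive integer and $p\to\infty$. The factor model is $y_t=Bf_t+u_t$, where $B$ is a $p\times K$ non-random matrix, $f_t\in\mathbb R^K$ is a vector of common factors and $u_t\in\mathbb R^p$ an error vector uncorrelated with $f_t$; $\Sigma_u=\mathrm{cov}(u_t)$ and $\Sigma=\mathrm{cov}(y_t)=B\,\mathrm{cov}(f_t)B'+\Sigma_u$. $\tilde b_1,\dots,\tilde b_K$ are the columns of $B$, ordered so that $\|\tilde b_1\|\ge\dots\ge\|\tilde b_K\|$ (Euclidean norm). $\lambda_1\ge\dots\ge\lambda_p$ are the eigenvalues of $\Sigma$. For matrices $\|\cdot\|$ is the spectral norm. *)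

(* Defs.v *)
From HB Require Import structures.
From mathcomp Require Import all_boot all_order all_algebra.
From mathcomp Require Import all_classical all_reals all_analysis.

Set Implicit Arguments.
Unset Strict Implicit.
Unset Printing Implicit Defensive.

Import Order.TTheory GRing.Theory Num.Theory.
Import numFieldNormedType.Exports.

Local Open Scope classical_set_scope.
Local Open Scope ring_scope.

(* The library norm `|v| on 'M[R]_(m, n) is the max norm, so the Euclidean and
   spectral norms are defined here. *)
Definition euclid_norm (R : realType) (n : nat) (v : 'cV[R]_n) : R :=
  Num.sqrt (\sum_(i < n) v i 0 ^+ 2).

(* ||A|| = lambda_max(A'A)^(1/2); [sup] is a maximum as soon as 0 < n, and
   sup set0 = 0 gives the norm 0 when n = 0. *)
Definition spectral_norm (R : realType) (m n : nat) (A : 'M[R]_(m, n)) : R :=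
  Num.sqrt (sup [set a : R | eigenvalue (A^T *m A) a]).

(* lam lists, in nonincreasing order, all the eigenvalues of A repeated
   according to their multiplicity; lam 0 is the largest one. *)
Definition ordered_eigenvalues (R : realType) (n : nat) (A : 'M[R]_n)
    (lam : 'I_n -> R) : Prop :=
  (forall i j : 'I_n, (i <= j)%N -> lam j <= lam i) /\
  char_poly A = \prod_(i < n) ('X - (lam i)%:P).

(* Membership in Lfun includes measurability of the components. *)
Definition square_integrable (d : measure_display) (T : measurableType d)
    (R : realType) (P : probability T R) (n : nat) (X : T -> 'cV[R]_n) : Prop :=
  forall i : 'I_n, (fun w : T => X w i 0) \in Lfun P 2%:E.

(* The covariances are finite for square integrable X and Y, so that [fine]
   loses nothing. *)
Definition cross_cov (d : measure_display) (T : measurableType d)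
    (R : realType) (P : probability T R) (m n : nat)
    (X : T -> 'cV[R]_m) (Y : T -> 'cV[R]_n) : 'M[R]_(m, n) :=
  \matrix_(i < m, j < n)
    fine (covariance P (fun w : T => X w i 0) (fun w : T => Y w j 0)).

Definition cov_mx (d : measure_display) (T : measurableType d)
    (R : realType) (P : probability T R) (n : nat) (X : T -> 'cV[R]_n) :
    'M[R]_n :=
  cross_cov P X X.

(* Main.v *)
(* Since cov f = 1 and f, u are uncorrelated, cov y = B B' + cov u, so by Weyl's
   inequality the i-th eigenvalues of cov y and B B' differ by at most the
   spectral norm of cov u. As B B' and the diagonal matrix B' B have the same
   characteristic polynomial up to a power of X, the eigenvalues of B B' are the
   squared norms of the columns of B, padded with zeros. Weyl's inequality is
   proved by diagonalizing real symmetric matrices in a unitary basis over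
   R[i]. *)
Require Import Defs.
From HB Require Import structures.
From mathcomp Require Import all_boot all_order all_fingroup all_algebra.
From mathcomp Require Import complex polyrcf spectral sesquilinear.
From mathcomp Require Import all_classical all_reals all_analysis.

Set Implicit Arguments.
Unset Strict Implicit.
Unset Printing Implicit Defensive.

Import Order.TTheory GRing.Theory Num.Theory.
Import numFieldNormedType.Exports.

Local Open Scope classical_set_scope.
Local Open Scope ring_scope.

(** * Characteristic polynomials of the two products of rectangular matrices *)

(* Both determinants are Schur complements in the block matrix
   [['X, A], [B, 1]]. *)
Lemma char_poly_mulC (R : comNzRingType) m n (A : 'M[R]_(m, n))
    (B : 'M[R]_(n, m)) :
  'X^n * char_poly (A *m B) = 'X^m * char_poly (B *m A).
Proof.
rewrite /char_poly /char_poly_mx !map_mxM /=.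
move: (map_mx polyC A) (map_mx polyC B) => {}A {}B.
pose M : 'M[{poly R}]_(m + n) := block_mx 'X%:M A B 1%:M.
have detM : \det M = \det ('X%:M - A *m B).
  have := det_mulmx (block_mx 1%:M (- A) 0 1%:M) M.
  rewrite mulmx_block det_ublock !det1 !mul1r !mul1mx !mul0mx !add0r.
  by rewrite mulmx1 subrr det_lblock det1 mulr1 mulNmx => <-.
have := det_mulmx (block_mx 1%:M 0 (- B) 'X%:M) M.
rewrite mulmx_block det_lblock !mul1mx !mul0mx !addr0 mulNmx mulmx1.
rewrite scalar_mxC addNr det_ublock det1 mul1r !det_scalar detM => <-.
by rewrite mulNmx addrC.
Qed.

(** * Unitary diagonalization of real symmetric matrices *)

Local Open Scope sesquilinear_scope.

Lemma perm_mx_unitary (C : numClosedFieldType) n (s : 'S_n) :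
  perm_mx s \is @unitarymx C n n.
Proof.
by apply/unitarymxP; rewrite tr_perm_mx map_perm_mx -perm_mxM mulgV perm_mx1.
Qed.

(** Over [R[i]] the matrix is Hermitian, hence normal with real eigenvalues, so that taking real
    parts of the spectrum loses nothing. *)
Lemma symmetric_spectral (R : rcfType) n (A : 'M[R]_n) : A^T = A ->
  exists (U : 'M[R[i]]_n) (l : 'I_n -> R),
    [/\ U \is unitarymx,
        map_mx (real_complex R) A
          = U^t* *m diag_mx (\row_k real_complex R (l k)) *m U &
        char_poly A = \prod_k ('X - (l k)%:P)].
Proof.
move=> Asym; pose AC := map_mx (real_complex R) A.
have ACherm : AC \is hermsymmx.
  apply: realsym_hermsym.
    by apply/is_hermitianmxP; rewrite expr0 scale1r map_mx_id // map_trmx Asym.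
  by apply/mxOverP => i j; rewrite mxE complex_real.
have /orthomx_spectralP := hermitian_normalmx ACherm.
have := hermitian_spectral_diag_real ACherm.
have := spectral_unitarymx AC.
move: (spectralmx AC) (spectral_diag AC) => U sp Uu /mxOverP sp_real ACE.
have spE : sp = \row_k real_complex R (complex.Re (sp 0 k)).
  by apply/rowP => k; rewrite mxE RRe_real.
exists U, (fun k => complex.Re (sp 0 k)); split=> //.
  by rewrite -spE -invmx_unitary.
apply: (@map_poly_inj _ _ (real_complex R)).
(* The factor ['X^n] makes [char_poly_mulC] applicable; it moves [invmx U] to the right, where it
   cancels against [U]. *)
apply: (@mulfI _ ('X^n : {poly R[i]})); first by rewrite monic_neq0 ?monicXn.
rewrite map_char_poly -/AC ACE -mulmxA char_poly_mulC.
rewrite mulmxK ?unitarymx_unit //.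
rewrite char_poly_trig ?is_diag_mx_is_trig ?diag_mx_is_diag // rmorph_prod.
congr (_ * _); apply: eq_bigr => i _ /=.
by rewrite mxE eqxx mulr1n rmorphB /= map_polyX map_polyC /= RRe_real.
Qed.

(** Two factorizations of the characteristic polynomial into monic linear factors agree up to a
    permutation, which is absorbed into the unitary matrix. *)
Lemma ordered_eigenvalues_spectral (R : realType) n (A : 'M[R]_n)
    (lam : 'I_n -> R) : A^T = A -> ordered_eigenvalues A lam ->
  exists2 U : 'M[R[i]]_n, U \is unitarymx &
    map_mx (real_complex R) A
      = U^t* *m diag_mx (\row_k real_complex R (lam k)) *m U.
Proof.
move=> /symmetric_spectral[V [l [Vu AE Al]]] [_ Alam].
have : perm_eq [tuple lam i | i < n] [tuple l i | i < n].
  apply: prod_XsubC_eq; rewrite !big_tuple.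
  under eq_bigr do rewrite tnth_mktuple.
  under [RHS]eq_bigr do rewrite tnth_mktuple.
  by rewrite -Al -Alam.
case/tuple_permP => s sE.
have lE i : lam i = l (s i).
  have := congr1 (fun t => nth 0 t i) sE.
  by rewrite -!tnth_nth !tnth_mktuple.
exists (perm_mx s *m V); first by rewrite mul_unitarymx // perm_mx_unitary.
rewrite trmx_mul map_mxM /= tr_perm_mx map_perm_mx AE.
rewrite -!mulmxA; congr (_ *m _); rewrite !mulmxA; congr (_ *m _).
apply/matrixP => i j; rewrite -row_permE -[s in perm_mx s]invgK -col_permE !mxE.
rewrite (inj_eq perm_inj); case: eqP => [->|//].
by rewrite !mulr1n lE permKV.
Qed.

Lemma spectral_form (C : numClosedFieldType) n (U : 'M[C]_n) (d x : 'rV_n) :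
  (x *m (U^t* *m diag_mx d *m U) *m x^t*) 0 0
    = \sum_k d 0 k * `|(x *m U^t*) 0 k| ^+ 2.
Proof.
rewrite !mulmxA -(mulmxA _ U).
have -> : U *m x^t* = (x *m U^t*)^t* by rewrite trmx_mul map_mxM /= trmxCK.
rewrite mxE; apply: eq_bigr => k _.
by rewrite mul_mx_diag !mxE mulrAC normCK mulrC.
Qed.

(** Parseval's identity, obtained from [spectral_form] with all weights equal to 1. *)
Lemma unitary_norm (C : numClosedFieldType) n (U : 'M[C]_n) (x : 'rV_n) :
  U \is unitarymx -> (x *m x^t*) 0 0 = \sum_k `|(x *m U^t*) 0 k| ^+ 2.
Proof.
move=> Uu; rewrite -[x in x *m _]mulmx1.
have -> : 1%:M = U^t* *m diag_mx (const_mx 1) *m U.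
  by rewrite diag_const_mx mulmx1 -invmx_unitary // mulVmx // unitarymx_unit.
by rewrite spectral_form; apply: eq_bigr => k _; rewrite mxE mul1r.
Qed.

(** * Spectral norm and Weyl's inequality *)

(** By symmetry [a ^+ 2] is an eigenvalue of [A^T *m A]; the Cauchy bound on the roots of the
    characteristic polynomial shows that the supremum is over a bounded set. *)
Lemma le_spectral_norm (R : realType) n (A : 'M[R]_n) (a : R) :
  A^T = A -> eigenvalue A a -> `|a| <= spectral_norm A.
Proof.
move=> Asym /eigenvalueP[v vA v0].
rewrite -sqrtr_sqr ler_wsqrtr //; apply: ub_le_sup; last first.
  apply/eigenvalueP; exists v => //.
  by rewrite Asym mulmxA vA -scalemxAl vA scalerA expr2.
exists (cauchy_bound (char_poly (A^T *m A))) => b /=.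
rewrite eigenvalue_root_char => /rootP.
move=> /(cauchy_boundP (monic_neq0 (char_poly_monic _)))/ltW.
exact/le_trans/ler_norm.
Qed.

(** In an orthonormal eigenbasis the form is a weighted sum of squares whose weights are eigenvalues
    of [E]. *)
Lemma spectral_norm_form (R : realType) n (E : 'M[R]_n) (x : 'rV[R[i]]_n) :
    E^T = E ->
  (x *m map_mx (real_complex R) E *m x^t*) 0 0
    <= real_complex R (spectral_norm E) * (x *m x^t*) 0 0.
Proof.
move=> Esym; have [U [l [Uu -> El]]] := symmetric_spectral Esym.
rewrite spectral_form (unitary_norm _ Uu) mulr_sumr ler_sum // => k _.
rewrite ler_wpM2r ?exprn_ge0 // mxE lecR (le_trans (ler_norm _)) //.
apply: le_spectral_norm => //; rewrite eigenvalue_root_char El /root.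
by rewrite horner_prod (bigD1 k) //= hornerXsubC subrr mul0r.
Qed.

Lemma spectral_normN (R : realType) m n (A : 'M[R]_(m, n)) :
  spectral_norm (- A) = spectral_norm A.
Proof. by rewrite /spectral_norm mulmxN linearN /= mulNmx opprK. Qed.

(* The subspaces spanned by the last [n - i] eigenvectors of A and the first
   [i + 1] ones of S meet in a nonzero vector: it is a kernel vector of a
   square matrix whose i-th column vanishes. *)
Lemma weyl_le (R : realType) n (S A : 'M[R]_n) (lam mu : 'I_n -> R) (i : 'I_n) :
    S^T = S -> A^T = A ->
    ordered_eigenvalues S lam -> ordered_eigenvalues A mu ->
  lam i - mu i <= spectral_norm (S - A).
Proof.
move=> Ssym Asym Slam Amu.
have [U Uu SE] := ordered_eigenvalues_spectral Ssym Slam.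
have [V Vu AE] := ordered_eigenvalues_spectral Asym Amu.
pose M : 'M[R[i]]_n := \matrix_(j, k)
  if (k < i)%N then (V^t*) j k else if (i < k)%N then (U^t*) j k else 0.
have /det0P[x x0 xM] : \det M == 0.
  rewrite (expand_det_col _ i) big1 // => j _.
  by rewrite mxE ltnn mul0r.
have xV (k : 'I_n) : (k < i)%N -> (x *m V^t*) 0 k = 0.
  move=> ki; transitivity ((x *m M) 0 k); last by rewrite xM mxE.
  rewrite !mxE; apply: eq_bigr => j _; by rewrite !mxE ki.
have xU (k : 'I_n) : (i < k)%N -> (x *m U^t*) 0 k = 0.
  move=> ik; transitivity ((x *m M) 0 k); last by rewrite xM mxE.
  rewrite !mxE; apply: eq_bigr => j _; by rewrite !mxE ik ltnNge ltnW.
pose N := (x *m x^t*) 0 0.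
have N_gt0 : 0 < N.
  rewrite /N mxE lt_neqAle eq_sym; apply/andP; split; last first.
    by apply: sumr_ge0 => j _; rewrite !mxE -normCK exprn_ge0.
  apply: contra x0 => /eqP xx0; apply/eqP/rowP => j; rewrite mxE.
  have /psumr_eq0P/(_ xx0 j isT)/eqP : forall k : 'I_n, true -> 0 <= x 0 k * x^t* k 0.
    by move=> k _; rewrite !mxE -normCK exprn_ge0.
  by rewrite !mxE -normCK sqrf_eq0 normr_eq0 => /eqP.
(* Only the coordinates [k <= i] of [x] in the eigenbasis of [S] survive, and there [lam k] is at
   least [lam i]. The bound for [A] is dual. *)
have Sx : real_complex R (lam i) * N
    <= (x *m map_mx (real_complex R) S *m x^t*) 0 0.
  rewrite SE spectral_form /N (unitary_norm _ Uu) mulr_sumr ler_sum // => k _.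
  have [ki|ik] := leqP k i.
    by rewrite ler_wpM2r ?exprn_ge0 // mxE lecR; apply: Slam.1.
  by rewrite xU // normr0 expr0n !mulr0.
have Ax : (x *m map_mx (real_complex R) A *m x^t*) 0 0
    <= real_complex R (mu i) * N.
  rewrite AE spectral_form /N (unitary_norm _ Vu) mulr_sumr ler_sum // => k _.
  have [ik|ki] := leqP i k.
    by rewrite ler_wpM2r ?exprn_ge0 // mxE lecR; apply: Amu.1.
  by rewrite xV // normr0 expr0n !mulr0.
rewrite -lecR -(ler_pM2r N_gt0) rmorphB mulrBl.
apply: le_trans (lerB Sx Ax) _.
have -> : (x *m map_mx (real_complex R) S *m x^t*) 0 0
    - (x *m map_mx (real_complex R) A *m x^t*) 0 0
    = (x *m map_mx (real_complex R) (S - A) *m x^t*) 0 0.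
  by rewrite map_mxB mulmxBr mulmxBl [RHS]mxE [X in _ = _ + X]mxE.
by apply: spectral_norm_form; rewrite linearB /= Ssym Asym.
Qed.

(** The lower bound is [weyl_le] with the two matrices exchanged. *)
Lemma weyl (R : realType) n (S A : 'M[R]_n) (lam mu : 'I_n -> R) (i : 'I_n) :
    S^T = S -> A^T = A ->
    ordered_eigenvalues S lam -> ordered_eigenvalues A mu ->
  `|lam i - mu i| <= spectral_norm (S - A).
Proof.
move=> Ssym Asym Slam Amu; rewrite ler_norml weyl_le // andbT lerNl opprB.
by rewrite -spectral_normN opprB weyl_le.
Qed.

(** * Spectrum of [B *m B^T] when the columns of [B] are orthogonal *)

Lemma gram_diag (R : realType) p K (B : 'M[R]_(p, K)) (j : 'I_K) :
  (B^T *m B) j j = euclid_norm (col j B) ^+ 2.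
Proof.
rewrite sqr_sqrtr ?sumr_ge0 // => [|i _]; last exact: sqr_ge0.
by rewrite mxE; apply: eq_bigr => i _; rewrite !mxE expr2.
Qed.

(* Otherwise the first [p + 1] columns would be nonzero and orthogonal. *)
Lemma orthogonal_col_eq0 (R : realType) p K (B : 'M[R]_(p, K)) (j : 'I_K) :
    is_diag_mx (B^T *m B) ->
    (forall i k : 'I_K, (i <= k)%N ->
      euclid_norm (col k B) <= euclid_norm (col i B)) ->
  (p <= j)%N -> euclid_norm (col j B) = 0.
Proof.
move=> /is_diag_mxP Bdiag Bsorted pj; apply/eqP; apply: contraT => bj0.
have pK : (p.+1 <= K)%N by apply: leq_ltn_trans pj (ltn_ord j).
pose h := widen_ord pK; pose B' := colsub h B.
(* [B'^T] has [p.+1] rows but rank at most [p]. Multiplying a kernel vector by the diagonal Gram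
   matrix will show that each of its entries vanishes. *)
have : kermx B'^T != 0.
  by rewrite -mxrank_eq0 mxrank_ker -lt0n subn_gt0 ltnS rank_leq_col.
case/rowV0Pn => v /sub_kermxP vB' /eqP[]; apply/rowP => k; rewrite mxE.
have : (v *m (B'^T *m B')) 0 k = 0 by rewrite mulmxA vB' mul0mx mxE.
have -> : B'^T *m B' = mxsub h h (B^T *m B).
  by apply/matrixP => a b; rewrite !mxE; apply: eq_bigr => c _; rewrite !mxE.
rewrite mxE (bigD1 k) //= big1 ?addr0 => [|l lk]; last first.
  by rewrite mxE Bdiag ?mulr0 // (inj_eq (@widen_ord_inj _ _ _)).
move=> /eqP; rewrite mxE gram_diag mulf_eq0 sqrf_eq0 => /orP[/eqP //|/eqP bk0].
(* If column [k] vanishes, so does column [j], since [k <= p <= j] and the norms are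
   nonincreasing. *)
move: bj0; rewrite eq_le sqrtr_ge0 andbT => /negP[].
by rewrite -bk0 Bsorted //= (leq_trans _ pj) // -ltnS.
Qed.

(** Each factor of index at least [m] is ['X]; this accounts for the zero eigenvalues by which the
    spectra of [B *m B^T] and [B^T *m B] differ. *)
Lemma prod_XsubC_pad (R : comNzRingType) (g : nat -> R) m n : (m <= n)%N ->
    (forall k, (m <= k < n)%N -> g k = 0) ->
  'X^m * \prod_(k < n) ('X - (g k)%:P) = 'X^n * \prod_(k < m) ('X - (g k)%:P).
Proof.
move=> mn g0; rewrite -!(big_mkord xpredT (fun k => 'X - (g k)%:P)).
rewrite (big_cat_nat (leq0n m) mn) /= mulrCA [RHS]mulrC; congr (_ * _).
rewrite (eq_big_nat _ _ (F2 := fun=> 'X)) => [|k kmn].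
  by rewrite prodr_const_nat -exprD subnKC.
by rewrite g0 // subr0.
Qed.

(* Extended by 0 beyond the last column. *)
Definition sqnorm_col (R : realType) p K (B : 'M[R]_(p, K)) (k : nat) : R :=
  if insub k is Some j then euclid_norm (col (j : 'I_K) B) ^+ 2 else 0.

Lemma sqnorm_col_ord (R : realType) p K (B : 'M[R]_(p, K)) (j : 'I_K) :
  sqnorm_col B j = euclid_norm (col j B) ^+ 2.
Proof. by rewrite /sqnorm_col valK. Qed.

Lemma sqnorm_col_ge (R : realType) p K (B : 'M[R]_(p, K)) k :
  (K <= k)%N -> sqnorm_col B k = 0.
Proof. by move=> Kk; rewrite /sqnorm_col insubF // ltnNge Kk. Qed.

Lemma ordered_eigenvalues_mul_tr (R : realType) p K (B : 'M[R]_(p, K)) :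
    is_diag_mx (B^T *m B) ->
    (forall i j : 'I_K, (i <= j)%N ->
      euclid_norm (col j B) <= euclid_norm (col i B)) ->
  ordered_eigenvalues (B *m B^T) (fun i : 'I_p => sqnorm_col B i).
Proof.
move=> Bdiag Bsorted; split=> [i j ij|].
  have [jK|Kj] := ltnP j K; last first.
    rewrite (sqnorm_col_ge _ Kj) /sqnorm_col.
    by case: insub => // k; exact: sqr_ge0.
  have iK := leq_ltn_trans ij jK.
  rewrite -[nat_of_ord j]/(nat_of_ord (Ordinal jK)).
  rewrite -[nat_of_ord i]/(nat_of_ord (Ordinal iK)) !sqnorm_col_ord.
  by rewrite lerXn2r ?nnegrE ?sqrtr_ge0 ?Bsorted.
apply: (@mulfI _ ('X^K : {poly R})); first by rewrite monic_neq0 ?monicXn.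
rewrite char_poly_mulC char_poly_trig ?is_diag_mx_is_trig //.
under eq_bigr do rewrite gram_diag -sqnorm_col_ord.
(* The surplus factors come from vanishing columns if [p <= K], and from the extension of
   [sqnorm_col] by 0 otherwise. *)
have [pK|Kp] := leqP p K.
  apply: prod_XsubC_pad => // k /andP[pk kK].
  rewrite -[k]/(nat_of_ord (Ordinal kK)) sqnorm_col_ord orthogonal_col_eq0 //.
  by rewrite expr0n.
apply/esym/prod_XsubC_pad => [|k /andP[Kk _]]; first exact: ltnW.
exact: sqnorm_col_ge.
Qed.

(** * Linearity of real-valued covariances *)

Section CrossCovariance.
Context (d : measure_display) (T : measurableType d) (R : realType)
  (P : probability T R).

Let Pfin : P setT \is a fin_num := fin_num_measure P _ measurableT.

(** On a probability space square integrable variables are integrable, and so is their product.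
    Finiteness is what lets [fine] commute with sums and products below. *)
Lemma covariance_fin_num2 (X Y : T -> R) : X \in Lfun P 2%:E ->
  Y \in Lfun P 2%:E -> covariance P X Y \is a fin_num.
Proof.
move=> X2 Y2; apply: covariance_fin_num; last exact: Lfun2_mul_Lfun1.
  exact: (Lfun_subset12 Pfin).
exact: (Lfun_subset12 Pfin).
Qed.

Lemma fine_covarianceDl (X Y Z : T -> R) : X \in Lfun P 2%:E ->
  Y \in Lfun P 2%:E -> Z \in Lfun P 2%:E ->
  fine (covariance P (X \+ Y) Z)
    = fine (covariance P X Z) + fine (covariance P Y Z).
Proof.
by move=> X2 Y2 Z2; rewrite covarianceDl // fineD // covariance_fin_num2.
Qed.

Lemma fine_covarianceZl (a : R) (X Z : T -> R) : X \in Lfun P 2%:E ->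
  Z \in Lfun P 2%:E ->
  fine (covariance P (a \o* X) Z) = a * fine (covariance P X Z).
Proof.
move=> X2 Z2; rewrite covarianceZl.
- by rewrite fineM // covariance_fin_num2.
- exact: (Lfun_subset12 Pfin).
- exact: (Lfun_subset12 Pfin).
- exact: Lfun2_mul_Lfun1.
Qed.

Lemma Lfun2D (X Y : T -> R) : X \in Lfun P 2%:E -> Y \in Lfun P 2%:E ->
  X \+ Y \in Lfun P 2%:E.
Proof. by apply: rpredD => //; rewrite lee_fin ler1n. Qed.

Lemma lincomb_Lfun2 (I : Type) (r : seq I) (a : I -> R) (X : I -> T -> R) :
    (forall i, X i \in Lfun P 2%:E) ->
  (fun w => \sum_(i <- r) a i * X i w) \in Lfun P 2%:E.
Proof.
move=> X2; elim: r => [|i r IHr].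
  rewrite (_ : (fun _ => _) = cst 0) ?Lfun_cst //.
  by apply/funext => w; rewrite big_nil.
rewrite (_ : (fun _ => _)
    = (a i \o* X i) \+ (fun w => \sum_(k <- r) a k * X k w)).
  by apply: Lfun2D => //; apply: Lfun_scale => //; rewrite ler1n.
by apply/funext => w /=; rewrite big_cons mulrC.
Qed.

Lemma fine_covariance_lincombl (I : Type) (r : seq I) (a : I -> R)
    (X : I -> T -> R) (Z : T -> R) :
    (forall i, X i \in Lfun P 2%:E) -> Z \in Lfun P 2%:E ->
  fine (covariance P (fun w => \sum_(i <- r) a i * X i w) Z)
    = \sum_(i <- r) a i * fine (covariance P (X i) Z).
Proof.
move=> X2 Z2; elim: r => [|i r IHr].
  rewrite big_nil (_ : (fun _ => _) = cst 0) ?covariance_cst_l //.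
  by apply/funext => w; rewrite big_nil.
rewrite big_cons -IHr -fine_covarianceZl // -fine_covarianceDl //.
- congr (fine (covariance P _ Z)); apply/funext => w /=.
  by rewrite big_cons mulrC.
- by apply: Lfun_scale => //; rewrite ler1n.
- exact: lincomb_Lfun2.
Qed.

End CrossCovariance.

(** * Covariance matrix of the factor model *)

Section FactorModel.
Context (d : measure_display) (T : measurableType d) (R : realType)
  (P : probability T R).

Lemma cross_cov_tr m n (X : T -> 'cV[R]_m) (Y : T -> 'cV[R]_n) :
  (cross_cov P X Y)^T = cross_cov P Y X.
Proof. by apply/matrixP => i j; rewrite !mxE covarianceC. Qed.

Lemma square_integrableD m (X Y : T -> 'cV[R]_m) : square_integrable P X ->
  square_integrable P Y -> square_integrable P (fun w => X w + Y w).
Proof.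
move=> X2 Y2 i.
rewrite (_ : (fun _ => _) = (fun w => X w i 0) \+ (fun w => Y w i 0)).
  exact: Lfun2D.
by apply/funext => w; rewrite mxE.
Qed.

Lemma square_integrable_mulmx m n (B : 'M[R]_(m, n)) (X : T -> 'cV[R]_n) :
  square_integrable P X -> square_integrable P (fun w => B *m X w).
Proof.
move=> X2 i; rewrite (_ : (fun _ => _) = (fun w => \sum_k B i k * X w k 0)).
  exact: lincomb_Lfun2.
by apply/funext => w; rewrite mxE.
Qed.

Lemma cross_covDl m n (X Y : T -> 'cV[R]_m) (Z : T -> 'cV[R]_n) :
    square_integrable P X -> square_integrable P Y -> square_integrable P Z ->
  cross_cov P (fun w => X w + Y w) Z = cross_cov P X Z + cross_cov P Y Z.
Proof.
move=> X2 Y2 Z2; apply/matrixP => i j; rewrite !mxE -fine_covarianceDl //.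
by congr (fine (covariance P _ _)); apply/funext => w; rewrite mxE.
Qed.

Lemma cross_cov_mulmxl m n k (B : 'M[R]_(m, k)) (X : T -> 'cV[R]_k)
    (Z : T -> 'cV[R]_n) :
    square_integrable P X -> square_integrable P Z ->
  cross_cov P (fun w => B *m X w) Z = B *m cross_cov P X Z.
Proof.
move=> X2 Z2; apply/matrixP => i j; rewrite !mxE.
under [RHS]eq_bigr do rewrite mxE.
rewrite -fine_covariance_lincombl //.
by congr (fine (covariance P _ _)); apply/funext => w; rewrite mxE.
Qed.

Lemma cov_mx_factor_model p K (B : 'M[R]_(p, K)) (f : T -> 'cV[R]_K)
    (u : T -> 'cV[R]_p) :
    square_integrable P f -> square_integrable P u -> cross_cov P f u = 0 ->
  cov_mx P (fun w => B *m f w + u w) = B *m cov_mx P f *m B^T + cov_mx P u.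
Proof.
move=> f2 u2 fu0; have Bf2 := square_integrable_mulmx B f2.
have y2 := square_integrableD Bf2 u2.
rewrite /cov_mx cross_covDl // cross_cov_mulmxl //.
(* Transposition exchanges the arguments, so that linearity on the left also expands the right
   one. *)
rewrite -[X in B *m X]cross_cov_tr -[X in _ + X = _]cross_cov_tr.
rewrite !cross_covDl // !cross_cov_mulmxl // fu0 mulmx0 add0r cross_cov_tr.
rewrite -(cross_cov_tr f u) fu0 trmx0 addr0 trmx_mul.
by rewrite cross_cov_tr mulmxA.
Qed.

End FactorModel.

(** * Growth of the column norms *)

(** The lower limit is the supremum of the tail infima, one of which is already at least [c]. *)
Lemma limn_einf_ge (R : realType) (v : (\bar R)^nat) (c : \bar R) :
  (\forall n \near \oo, (c <= v n)%E) -> (c <= limn_einf v)%E.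
Proof.
move=> [N _ cv]; rewrite limn_einf_lim (cvg_lim _ (@cvg_einfs_sup R v)) //.
apply: le_trans (ereal_sup_ubound (imageT _ N)).
by apply: le_ereal_inf_tmp => _ [k /= Nk <-]; exact: cv.
Qed.

(** The [j]-th standard basis vector is an eigenvector of the diagonal matrix. *)
Lemma eigenvalue_gram_diag (R : realType) p K (B : 'M[R]_(p, K)) (j : 'I_K)
    (a : R) : is_diag_mx (B^T *m B) ->
  eigenvalue (a *: (B^T *m B)) (a * euclid_norm (col j B) ^+ 2).
Proof.
move=> /is_diag_mxP Bdiag; apply/eigenvalueP; exists (delta_mx 0 j).
  rewrite -rowE; apply/rowP => k; rewrite !mxE eqxx -gram_diag /=.
  have [->|kj] := eqVneq k j; first by rewrite mulr1 mxE.
  rewrite mulr0; have := Bdiag j k; rewrite mxE => ->; rewrite ?mulr0 //.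
  by rewrite eq_sym.
by apply/negP => /eqP/rowP/(_ j)/eqP; rewrite !mxE !eqxx oner_eq0.
Qed.

Unset Implicit Arguments.
Local Close Scope sesquilinear_scope.

Theorem proposition2p1 (R : realType) (K : nat) (K_gt0 : (0 < K)%N)
    (d : nat -> measure_display) (T : forall p : nat, measurableType (d p))
    (P : forall p : nat, probability (T p) R)
    (B : forall p : nat, 'M[R]_(p, K))
    (f : forall p : nat, T p -> 'cV[R]_K)
    (u y : forall p : nat, T p -> 'cV[R]_p)
    (lam : forall p : nat, 'I_p -> R)
    (* the factor model y = B f + u, with u uncorrelated with f *)
    (f_L2 : forall p : nat, square_integrable (P p) (f p))
    (u_L2 : forall p : nat, square_integrable (P p) (u p))
    (fu_uncorrelated : forall p : nat, cross_cov (P p) (f p) (u p) = 0)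
    (yE : forall (p : nat) (w : T p), y p w = B p *m f p w + u p w)
    (B_ordered : forall (p : nat) (i j : 'I_K), (i <= j)%N ->
      euclid_norm (col j (B p)) <= euclid_norm (col i (B p)))
    (lamP : forall p : nat, ordered_eigenvalues (cov_mx (P p) (y p)) (lam p))
    (* the eigenvalues of p^-1 B'B are bounded away from zero for large p *)
    (B_pervasive : exists2 c : R, 0 < c &
      \forall p \near \oo, forall a : R,
        eigenvalue (p%:R^-1 *: ((B p)^T *m B p)) a -> c <= a)
    (* the canonical condition *)
    (cov_f : forall p : nat, cov_mx (P p) (f p) = 1%:M)
    (B_diag : forall p : nat, is_diag_mx ((B p)^T *m B p)) :
  (forall (p : nat) (i : 'I_p) (j : 'I_K), i = j :> nat ->
     `| lam p i - euclid_norm (col j (B p)) ^+ 2 |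
       <= spectral_norm (cov_mx (P p) (u p))) /\
  (forall (p : nat) (i : 'I_p), (K <= i)%N ->
     `| lam p i | <= spectral_norm (cov_mx (P p) (u p))) /\
  (forall j : 'I_K,
     (0 < limn_einf (fun p : nat =>
            (euclid_norm (col j (B p)) ^+ 2 / p%:R)%:E))%E).
Proof.
have cov_yE p : cov_mx (P p) (y p) = B p *m (B p)^T + cov_mx (P p) (u p).
  rewrite (_ : y p = fun w => B p *m f p w + u p w); last exact/funext.
  by rewrite cov_mx_factor_model // cov_f mulmx1.
have cov_sym p : (cov_mx (P p) (u p))^T = cov_mx (P p) (u p).
  exact: cross_cov_tr.
(* Both eigenvalue bounds are instances of this one: [sqnorm_col] is the squared column norm below
   [K] and 0 from [K] on. *)
have weylB p (i : 'I_p) : `|lam p i - sqnorm_col (B p) i|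
    <= spectral_norm (cov_mx (P p) (u p)).
  have -> : cov_mx (P p) (u p) = cov_mx (P p) (y p) - B p *m (B p)^T.
    by rewrite cov_yE addrC addKr.
  have BBsym : (B p *m (B p)^T)^T = B p *m (B p)^T.
    by rewrite trmx_mul trmxK.
  apply: (weyl (mu := fun i : 'I_p => sqnorm_col (B p) i)) => //.
    by rewrite cov_yE linearD /= BBsym cov_sym.
  exact: ordered_eigenvalues_mul_tr (B_diag p) (@B_ordered p).
split; [|split].
- by move=> p i j ij; rewrite -sqnorm_col_ord -ij.
- by move=> p i Ki; rewrite -[lam p i]subr0 -(sqnorm_col_ge (B p) Ki).
move=> j; have [c c_gt0 B_eig] := B_pervasive.
(* The pervasiveness constant [c] bounds the lower limit, because the squared norm divided by [p] is
   itself an eigenvalue of the scaled Gram matrix. *)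
apply: (@lt_le_trans _ _ c%:E); first by rewrite lte_fin.
apply: limn_einf_ge; near=> p; rewrite lee_fin mulrC.
have : forall a, eigenvalue (p%:R^-1 *: ((B p)^T *m B p)) a -> c <= a.
  by near: p.
by apply; exact: eigenvalue_gram_diag (B_diag p).
Unshelve. all: by end_near.
Qed.
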